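(* Let $\alpha\ge1$ be an integer and let $G$ be a graph with chromatic number $\chi(G)\le\alpha$. Then $G$ admits a partial edge colouring using at most $3\lceil\log_2\alpha\rceil$ colours such that all edges of $G$ are satisfied, except possibly for the edges of a set $M$ of uncoloured edges forming a matching.
   Context: For an edge $e=uv$, $E[e]$ is the set of edges incident with $u$ or $v$ and $E(e)=E[e]\setminus\{e\}$. In a partial edge colouring (not all edges need be coloured), a colour $\beta$ is unique for $e$ if $\beta$ appears on some edge $e'\in E(e)$ and on no other edge of $E[e]\setminus\{e'\}$; $e$ is satisfied if such a colour exists. *)

(* Defs.v *)
(* A simple graph on a finType T is a symmetric irreflexive
   relation g; an edge is the 2-element set {u,v} with g u v. *)
From mathcomp Require Import all_boot.
Set Implicit Arguments. Unset Strict Implicit. Unset Printing Implicit Defensive.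

Section Defs.
Variable T : finType.
Variable g : rel T.

Definition is_edge (A : {set T}) : bool :=
  [exists u, exists v, g u v && (A == [set u; v])].

Definition incident (A f : {set T}) : bool :=
  is_edge f && (f :&: A != set0).

(* partial edge colouring: c A = None means A is uncoloured *)
Definition unique_colour (K : Type) (c : {set T} -> option K) (A : {set T}) (beta : K) : Prop :=
  exists f, [/\ incident A f, f != A, c f = Some beta &
    forall f', incident A f' -> f' != f -> c f' <> Some beta].

Definition satisfied (K : Type) (c : {set T} -> option K) (A : {set T}) : Prop :=
  exists beta, unique_colour c A beta.

Definition matching (M : {set {set T}}) : Prop :=
  (forall A, A \in M -> is_edge A) /\
  (forall A B, A \in M -> B \in M -> A != B -> [disjoint A & B]).

Definition colourable (k : nat) : Prop :=
  exists f : T -> 'I_k, forall x y, g x y -> f x != f y.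
End Defs.

(* Main.v *)
(** The vertex colours are read in binary: splitting along one bit leaves a
    bipartite graph [h] of crossing edges, and an inner graph that needs one bit
    less.  By induction the inner graph is coloured with an exceptional matching,
    encoded by the involution [mu]; three fresh colours must now satisfy all
    edges of [h] and of [mu] up to an uncoloured matching.

    Let X and Y be the sides of [h].  For every x in X with a neighbour of
    degree one, reserve one such leaf [p x].  The other non-isolated vertices of
    Y form [Y1]; choose an inclusion-minimal dominating set [D1] for them, with
    private neighbours [q d], in two rounds so that the private neighbour of a
    centre without a leaf is adjacent to no vertex with a leaf.  Colour [d q(d)]
    with 1, one edge from a centre to each further vertex of [Y1] with 2, and
    with 3 either [d p(d)] or one further edge [q(d) r(d)] at [q d].  Then all
    edges of [h] are satisfied except some [x p(x)] with x outside [D1].  If such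
    an edge meets an unsatisfied edge of [mu], colouring these edges with 1,
    2, 3 satisfies them without harming the others. *)
Require Import Defs.
From mathcomp Require Import all_boot.
Set Implicit Arguments. Unset Strict Implicit. Unset Printing Implicit Defensive.

(** * Satisfied edges in terms of pairs of vertices *)

(** Colourings are symmetric functions on pairs of vertices; the value 0 stands
    for an uncoloured edge. *)
Section Satisfaction.
Variables (T : finType) (col : T -> T -> nat).

(** An edge that meets [u v] without being [u v] has exactly one end in common with it. Here that
    end is [u]; [sat] allows either. *)
Definition sat_at (u v : T) : bool :=
  [exists z, [&& z != v, 0 < col u z,
    [forall z', (col u z' == col u z) ==> (z' == z)] &
    [forall z', col v z' != col u z]]].

Definition sat (u v : T) : bool := sat_at u v || sat_at v u.

Lemma sat_atP u v :
  reflect (exists z, [/\ z <> v, 0 < col u z,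
             forall z', col u z' = col u z -> z' = z &
             forall z', col v z' <> col u z])
          (sat_at u v).
Proof.
apply: (iffP existsP) => -[z].
  case/and4P=> /eqP zv c0 /forallP uq /forallP nv; exists z; split=> // z'.
    by move=> e; apply/eqP; apply: (implyP (uq z')); apply/eqP.
  by apply/eqP.
case=> zv c0 uq nv; exists z; apply/and4P; split=> //; first exact/eqP.
  by apply/forallP=> z'; apply/implyP=> /eqP /uq ->.
by apply/forallP=> z'; apply/eqP/nv.
Qed.

Lemma satC u v : sat u v = sat v u.
Proof. by rewrite /sat orbC. Qed.

Lemma sat_intro u v z : z <> v -> 0 < col u z ->
  (forall z', col u z' = col u z -> z' = z) ->
  (forall z', col v z' <> col u z) -> sat u v.
Proof. by move=> *; apply/orP; left; apply/sat_atP; exists z. Qed.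

End Satisfaction.

(** * Minimal dominating sets and private neighbours *)

Section MinimalDomination.
Variables (T : finType) (h : rel T).

(** In an inclusion-minimal dominating set, deleting [d] leaves some [q] undominated; [q] is then a
    neighbour of [d] and of no other member. *)
Lemma minimal_domination (S R : {set T}) :
    (forall y, y \in R -> exists2 x, x \in S & h x y) ->
  exists D : {set T}, [/\ D \subset S,
    forall y, y \in R -> exists2 x, x \in D & h x y &
    forall d, d \in D -> exists q, [/\ q \in R, h d q &
      forall d', d' \in D -> h d' q -> d' = d]].
Proof.
move=> domS.
pose dom (D : {set T}) := [forall y in R, [exists x in D, h x y]].
have domP (D : {set T}) : reflect (forall y, y \in R -> exists2 x, x \in D & h x y) (dom D).
  apply: (iffP forall_inP) => H y /H.
    by case/exists_inP=> x; exists x.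
  by case=> x xD hxy; apply/exists_inP; exists x.
have [D /minsetP[/domP domD minD] sDS] := minset_exists (introT (domP S) domS).
exists D; split=> // d dD.
have : ~~ dom (D :\ d).
  apply/negP=> /minD /(_ (subsetDl _ _)) e.
  by move: dD; rewrite -e !inE eqxx.
rewrite negb_forall_in => /exists_inP[q qR]; rewrite negb_exists_in => /forall_inP nq.
have uq d' : d' \in D -> h d' q -> d' = d.
  move=> d'D hd'q; apply/eqP; case: eqVneq => // ne.
  by have := nq d'; rewrite !inE ne d'D hd'q => /(_ isT).
exists q; split=> //.
by have [x xD hxq] := domD _ qR; rewrite -(uq _ xD hxq).
Qed.

End MinimalDomination.

(** * Three colours for a bipartite graph together with a matching *)

Section BipartiteStep.
Variables (T : finType) (side : pred T) (h : rel T) (mu : T -> T).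
Hypothesis hC : symmetric h.
Hypothesis h_side : forall x y, h x y -> side x != side y.
Hypothesis muK : involutive mu.
Hypothesis mu_side : forall x, side (mu x) = side x.

Variables (Lf A D' : {set T}) (p q s r : T -> T).
Let D1 : {set T} := A :|: D'.
Let Y1 : {set T} := [set y | [&& ~~ side y, [exists x, h x y] & y \notin p @: Lf]].
Hypothesis LfX : forall x, x \in Lf -> side x.
Hypothesis AX : forall x, x \in A -> side x.
Hypothesis D'L : forall x, x \in D' -> x \in Lf.
Hypothesis AL : forall x, x \in A -> x \notin Lf.
Hypothesis ph : forall x, x \in Lf -> h x (p x).
Hypothesis p_leaf : forall x z, x \in Lf -> h z (p x) -> z = x.
Hypothesis sD : forall y, y \in Y1 -> s y \in D1.
Hypothesis sh : forall y, y \in Y1 -> h (s y) y.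
Hypothesis qY : forall d, d \in D1 -> q d \in Y1.
Hypothesis q_priv : forall d d', d \in D1 -> d' \in D1 -> h d' (q d) -> d' = d.
Hypothesis qA : forall d x, d \in A -> x \in Lf -> ~~ h x (q d).
Hypothesis rh : forall d, d \in A -> h (r d) (q d).
Hypothesis r_neq : forall d, d \in A -> r d <> d.

(* [K] and [PJ] collect the ends, in X and in Y, of the edges of [mu] that are
   recoloured; comparing ranks breaks the symmetry when both ends qualify. *)
Let L0 : {set T} := Lf :\: D'.
Let K : {set T} := [set x in L0 | (mu x != x) && (mu x \notin D1)].
Let rk (x : T) : nat := enum_rank x.
Let K1 : {set T} := [set x in K | rk x < rk (mu x)].
Let P0 : {set T} := p @: (L0 :\: K).
Let iso w := ~~ [exists x, h x w].
Let PJ : {set T} :=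
  [set y in P0 | (mu y != y) && (iso (mu y) || (mu y \in P0))].
Let J1 : {set T} := [set x in L0 :\: K | (mu (p x) != p x) &&
  (iso (mu (p x)) || (mu (p x) \in P0) && (rk (p x) < rk (mu (p x))))].

(** When [x] and [mu x] both lie in [K], their leaf edges get different colours, so each colour is
    unseen at the other end. *)
Let kcol x := if x \in K1 then 1 else 2.
Let colh x y :=
  if (x \in Lf) && (y == p x) then
    if x \in D' then 3 else if x \in K then kcol x
    else if x \in J1 then 3 else 0
  else if y \in Y1 then
    if x == s y then if y == q x then 1 else 2
    else if [&& s y \in A, y == q (s y) & x == r (s y)] then 3 else 0
  else 0.
(** Possibly only one end lies in [K] or [PJ], so both are tested. In X the edge gets 3 and a leaf
    edge beside it 1 or 2; in Y it gets 1 and a leaf edge beside it 3. Each then serves to satisfy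
    the other. *)
Let colm u v :=
  if (v == mu u) && (v != u) then
    if side u then if (u \in K) || (v \in K) then 3 else 0
    else if (u \in PJ) || (v \in PJ) then 1 else 0
  else 0.
Let col u v :=
  if side u == side v then colm u v
  else if side u then colh u v else colh v u.

(** * Symmetry, sides and membership *)

Let colmC u v : colm u v = colm v u.
Proof.
rewrite /colm.
have -> : (u == mu v) && (u != v) = (v == mu u) && (v != u).
  by rewrite [u == v]eq_sym; congr (_ && _); apply/eqP/eqP=> ->; rewrite muK.
case: ifP => // /andP[/eqP -> _]; rewrite mu_side.
by rewrite orbC [(_ \in PJ) || _]orbC.
Qed.

Let colC u v : col u v = col v u.
Proof.
rewrite /col eq_sym; case: eqVneq => [e|]; first exact: colmC.
by case: (side u); case: (side v).
Qed.

Let colX x z : side x -> col x z = if side z then colm x z else colh x z.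
Proof. by rewrite /col => ->; case: (side z). Qed.

Let colY y z : ~~ side y -> col y z = if side z then colh z y else colm y z.
Proof. by rewrite /col => /negbTE ->; case: (side z). Qed.

Let hX x y : h x y -> side x -> ~~ side y.
Proof. by move/h_side; case: (side x); case: (side y). Qed.
Let hY x y : h x y -> ~~ side y -> side x.
Proof. by move/h_side; case: (side x); case: (side y). Qed.

Let D1X x : x \in D1 -> side x.
Proof. by rewrite inE => /orP[/AX|/D'L/LfX]. Qed.
Let D'D1 x : x \in D' -> x \in D1.
Proof. by rewrite inE => ->; rewrite orbT. Qed.
Let AD1 x : x \in A -> x \in D1.
Proof. by rewrite inE => ->. Qed.
Let D1L x : x \in D1 -> x \in Lf -> x \in D'.
Proof. by rewrite inE => /orP[/AL /negbTE ->|]. Qed.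
Let L0L x : x \in L0 -> x \in Lf.
Proof. by case/setDP. Qed.
Let L0D x : x \in L0 -> x \notin D1.
Proof. by case/setDP=> xL xD; apply: contra xD => /D1L ->. Qed.
Let L0X x : x \in L0 -> side x.
Proof. by move/L0L/LfX. Qed.
Let KL x : x \in K -> x \in L0.
Proof. by rewrite inE => /andP[]. Qed.
Let KL' x : x \notin L0 -> (x \in K) = false.
Proof. by move=> H; apply: contraNF H; apply: KL. Qed.
Let pY x : x \in Lf -> ~~ side (p x).
Proof. by move=> xL; apply: (hX (ph xL)); apply: LfX. Qed.
Let Y1Y y : y \in Y1 -> ~~ side y.
Proof. by rewrite inE => /and3P[]. Qed.
Let pY1 x : x \in Lf -> (p x \in Y1) = false.
Proof. by move=> xL; rewrite inE imset_f // !andbF. Qed.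
Let p_inj x x' : x \in Lf -> x' \in Lf -> p x = p x' -> x = x'.
Proof. by move=> xL x'L e; apply: p_leaf => //; rewrite -e; apply: ph. Qed.
Let P0E x : x \in Lf -> (p x \in P0) = (x \in L0 :\: K).
Proof.
move=> xL; apply/imsetP/idP => [[x' x'L e]|H]; last by exists x.
by rewrite (p_inj xL _ e) //; case/setDP: x'L => /L0L.
Qed.
Let P0Y1 y : y \in P0 -> (y \in Y1) = false.
Proof. by case/imsetP=> x /setDP[/L0L xL _] ->; apply: pY1. Qed.
Let pNiso x : x \in Lf -> iso (p x) = false.
Proof. by move=> xL; apply/negbF/existsP; exists x; apply: ph. Qed.
Let Y1Niso y : y \in Y1 -> iso y = false.
Proof. by rewrite inE => /and3P[_ H _]; rewrite /iso H. Qed.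
Let s_q d : d \in D1 -> s (q d) = d.
Proof. by move=> dD; apply: q_priv => //; [apply/sD/qY | apply/sh/qY]. Qed.
(** Privacy of [q d] excludes a second centre next to it. With [r_L], the extra edges of colour 3
    thus avoid centres and owners of leaves. *)
Let r_D d : d \in A -> r d \notin D1.
Proof.
move=> dA; apply/negP=> /(q_priv (AD1 dA)) /(_ (rh dA)); exact: r_neq.
Qed.
Let r_L d : d \in A -> r d \notin Lf.
Proof. by move=> dA; apply/negP=> /(qA dA); rewrite rh. Qed.
Let sX y : y \in Y1 -> side (s y).
Proof. by move/sD/D1X. Qed.
Let muL0K x : x \in L0 -> mu x != x -> (mu x \in K) = (mu x \in L0).
Proof.
move=> xL ne; apply/idP/idP; first exact: KL.
by move=> mL; rewrite inE mL muK eq_sym ne L0D.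
Qed.
Let PJ_mu y : mu y \in PJ -> iso y || (y \in P0).
Proof. by rewrite inE muK => /andP[_ /andP[]]. Qed.

(** * Colours seen at each kind of vertex *)

(** The edge of [mu] at [x] is uncoloured: were [mu x] in [K], it would lie outside [D1], and this
    would put [x] in [K]. *)
Let col_L0 x z : x \in L0 -> x \notin K ->
  col x z = if (x \in J1) && (z == p x) then 3 else 0.
Proof.
move=> xL xK; rewrite (colX _ (L0X xL)); case: ifP => zX.
  have /negbTE -> : z != p x.
    by apply: contraTneq zX => ->; apply/pY/L0L.
  rewrite andbF /colm; case: ifP => // /andP[/eqP -> ne].
  rewrite L0X // (negbTE xK) /= muL0K //; case: ifP => // mL.
  by case/negP: xK; rewrite inE xL ne L0D.
rewrite /colh L0L //=; case: eqP => _; rewrite ?andbT ?andbF.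
  by case/setDP: xL => _ /negbTE ->; rewrite (negbTE xK).
case: ifP => // zY; case: eqP => [e|_].
  by move: (L0D xL); rewrite e sD.
case: ifP => // /and3P[sA _ /eqP e].
by move: (r_L sA); rewrite -e L0L.
Qed.

Let col_idle x z : x \in L0 -> x \notin K -> x \notin J1 -> col x z = 0.
Proof. by move=> xL xK /negbTE xJ; rewrite col_L0 // xJ. Qed.

Let col_K x z : x \in K ->
  col x z = if z == p x then kcol x else if z == mu x then 3 else 0.
Proof.
move=> xK; have xL := KL xK; have := xK; rewrite inE => /and3P[_ ne mD].
rewrite (colX _ (L0X xL)); case: ifP => zX.
  case: eqP => [ze|_]; first by move: (pY (L0L xL)); rewrite -ze zX.
  rewrite /colm; case: eqP => //= ->; by rewrite ne L0X // xK.
rewrite /colh L0L //=; case: eqP => _.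
  by case/setDP: xL => _ /negbTE ->; rewrite xK.
case: (z =P mu x) => [ze|_]; first by move: zX; rewrite ze mu_side L0X.
case: ifP => // zY; case: eqP => [e|_].
  by move: (L0D xL); rewrite e sD.
case: ifP => // /and3P[sA _ /eqP e].
by move: (r_L sA); rewrite -e L0L.
Qed.

(** Both ends of an edge coloured because of [K] avoid [D1]. *)
Let colm_D1 x z : x \in D1 -> colm x z = 0.
Proof.
move=> xD; rewrite /colm; case: ifP => // /andP[/eqP -> _]; rewrite D1X //.
rewrite KL' /=; last by apply/negP=> /L0D; rewrite xD.
by case: ifP => //; rewrite inE muK xD !andbF.
Qed.

Let col_D1_1 x z : x \in D1 -> (col x z == 1) = (z == q x).
Proof.
move=> xD; rewrite (colX _ (D1X xD)) (colm_D1 _ xD); case: ifP => zX.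
  by case: (z =P q x) => // ze; move: (Y1Y (qY xD)); rewrite -ze zX.
rewrite /colh; case: ifP => [/andP[xL /eqP ->]|_].
  rewrite (D1L xD xL); case: (p x =P q x) => // e.
  by move: (qY xD); rewrite -e pY1.
case: ifP => [zY|zY]; last first.
  by case: (z =P q x) => // ze; move: (qY xD); rewrite -ze zY.
case: (x =P s z) => [_|ne]; first by case: (z == q x).
case: (z =P q x) => [ze|_]; first by case: ne; rewrite ze s_q.
by case: ifP.
Qed.

Let col_D'_3 x z : x \in D' -> (col x z == 3) = (z == p x).
Proof.
move=> xD; have xL := D'L xD; have xD1 := D'D1 xD.
rewrite (colX _ (D1X xD1)) (colm_D1 _ xD1); case: ifP => zX.
  by case: (z =P p x) => // ze; move: (pY xL); rewrite -ze zX.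
rewrite /colh xL xD /=; case: (z == p x) => //.
case: ifP => // zY; case: (x =P s z) => [_|_]; first by case: ifP.
case: ifP => // /and3P[sA _ /eqP e].
by move: (r_L sA); rewrite -e xL.
Qed.

Let col_A_3 x z : x \in A -> col x z <> 3.
Proof.
move=> xA; rewrite (colX _ (AX xA)) (colm_D1 _ (AD1 xA)); case: ifP => // zX.
rewrite /colh (negbTE (AL xA)) /=.
case: ifP => // zY; case: eqP => [_|_]; first by case: ifP.
case: ifP => // /and3P[sA _ /eqP e].
by move: (r_D sA); rewrite -e AD1.
Qed.

Let col_other x z : side x -> x \notin D1 -> x \notin Lf ->
  col x z = 3 \/ col x z = 0.
Proof.
move=> xX xD xL; rewrite colX //; case: ifP => zX.
  by rewrite /colm xX; do 2![case: ifP; auto].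
rewrite /colh (negbTE xL) /=; case: ifP; auto => zY.
case: eqP => [e|_]; first by move: xD; rewrite e sD.
by case: ifP; auto.
Qed.

(** Ends in Y of coloured edges of [mu] are reserved leaves or isolated in [h], so only edges of [h]
    matter here. *)
Let col_Y1 y z : y \in Y1 ->
  col y z = if z == s y then if y == q (s y) then 1 else 2
    else if [&& s y \in A, y == q (s y) & z == r (s y)] then 3 else 0.
Proof.
move=> yY; rewrite (colY _ (Y1Y yY)); case: ifP => zX.
  rewrite /colh; case: ifP => [/andP[zL /eqP ye]|_].
    by move: yY; rewrite ye pY1.
  by rewrite yY; case: eqP => [->|].
case: eqP => [ze|_]; first by move: zX; rewrite ze sX.
case: ifP => [/and3P[sA _ /eqP ze]|_].
  by move: zX; rewrite ze (hY (rh sA)) // Y1Y // qY // AD1.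
rewrite /colm (negbTE (Y1Y yY)); case: ifP => // /andP[/eqP -> _].
have yP : (y \in P0) = false.
  by apply: contraTF yY => /P0Y1 ->.
rewrite [y \in PJ]inE yP /=; case: ifP => // /PJ_mu.
by rewrite Y1Niso // yP.
Qed.

Let col_p x z : x \in Lf -> col (p x) z =
  if z == x then if x \in D' then 3 else if x \in K then kcol x
    else if x \in J1 then 3 else 0
  else if (p x \in PJ) && (z == mu (p x)) then 1 else 0.
Proof.
move=> xL; rewrite (colY _ (pY xL)); case: ifP => zX.
  rewrite /colh; case: (z =P x) => [->|ne]; first by rewrite xL eqxx.
  case: ifP => [/andP[zL /eqP e]|_].
    by case: ne; apply: p_inj.
  rewrite pY1 //; case: ifP => // /andP[_ /eqP ze].
  by move: zX; rewrite ze mu_side (negbTE (pY xL)).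
case: (z =P x) => [ze|_]; first by move: zX; rewrite ze LfX.
rewrite /colm (negbTE (pY xL)) andbC.
case: (z =P mu (p x)) => [->|_]; rewrite ?andbF ?andbT //=.
have e : p x \in PJ -> mu (p x) != p x by rewrite inE => /andP[_ /andP[]].
(* As [p x] is not isolated in [h], a partner in [PJ] forces [p x] into [P0], so testing [p x] alone
   suffices. *)
have e' : mu (p x) \in PJ -> mu (p x) != p x -> p x \in PJ.
  move=> mP ne; have := PJ_mu mP; rewrite pNiso //= => pP.
  rewrite inE pP ne /=; move: mP; rewrite inE => /andP[-> _].
  by rewrite orbT.
case: (boolP (p x \in PJ)) => [/e ->//|nP].
case: ifP => // ne; case: ifP => // mP.
by move: nP; rewrite e'.
Qed.

Let col_iso w z : ~~ side w -> iso w ->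
  col w z = if (mu w \in PJ) && (z == mu w) then 1 else 0.
Proof.
move=> wY wI; rewrite colY //; case: ifP => zX.
  have -> : (z == mu w) = false.
    by apply: contraNF wY => /eqP ze; move: zX; rewrite ze mu_side.
  rewrite andbF /colh; case: ifP => [/andP[zL /eqP e]|_].
    by move: wI; rewrite e pNiso.
  by case: ifP => // /Y1Niso; rewrite wI.
rewrite /colm (negbTE wY).
case: (z =P mu w) => [->|_]; rewrite ?andbF ?andbT //=.
rewrite [w \in PJ]inE.
have -> : (w \in P0) = false.
  apply/negP=> /imsetP[x /setDP[/L0L xL _] e].
  by move: wI; rewrite e pNiso.
rewrite /=; case: ifP => [ne|/eqP e]; first by [].
have -> // : (mu w \in PJ) = false.
by rewrite inE muK [w == _]eq_sym e eqxx andbF.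
Qed.

Let kcol12 x : kcol x = 1 \/ kcol x = 2.
Proof. by rewrite /kcol; case: ifP; auto. Qed.

Let side_neq x y : side x -> ~~ side y -> x <> y.
Proof. by move=> xX yY e; move: yY; rewrite -e xX. Qed.

Let side_neq' x y : side x -> ~~ side y -> y <> x.
Proof. by move=> xX yY /esym; apply: side_neq. Qed.

Let neq_mu_p x : x \in L0 -> x <> mu (p x).
Proof.
move=> xL; apply: side_neq; first exact: L0X.
by rewrite mu_side; apply/pY/L0L.
Qed.

Let neq_p_mu x : x \in L0 -> p x <> mu x.
Proof. by move=> xL e; apply: (neq_mu_p xL); rewrite e muK. Qed.

Let PJP0 y : y \in PJ -> y \in P0.
Proof. by rewrite inE => /andP[]. Qed.

Let J1PJ x : x \in J1 -> p x \in PJ.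
Proof.
rewrite inE => /andP[xLK /andP[ne H]].
rewrite inE P0E ?xLK ?ne /=; last by case/setDP: xLK => /L0L.
by case/orP: H => [->//|/andP[->]]; rewrite orbT.
Qed.

(** Within X, colours 1 and 2 are seen only at centres and in [K]; elsewhere they cannot repeat a
    colour 1 or 2 found at the other end of an edge. *)
Let col_30 x z : side x -> x \notin D1 -> x \notin K -> col x z = 3 \/ col x z = 0.
Proof.
move=> xX xD xK; case: (boolP (x \in Lf)) => xL; last exact: col_other.
have xL0 : x \in L0 by apply/setDP; split=> //; apply: contra xD => /D'D1.
by rewrite col_L0 //; case: ifP; auto.
Qed.

Let col_p_1 x z : x \in L0 -> x \notin K ->
  (col (p x) z == 1) = (p x \in PJ) && (z == mu (p x)).
Proof.
move=> xL xK; rewrite col_p ?L0L //; case/setDP: (xL) => _ /negbTE ->.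
rewrite (negbTE xK); case: (z =P x) => [->|_].
  have /negbTE -> : x != mu (p x).
    exact/eqP/neq_mu_p.
  by rewrite andbF; case: ifP.
by case: ifP.
Qed.

Let col_p_neq1 x z : x \in D' -> col (p x) z <> 1.
Proof.
move=> xD; have xL := D'L xD; rewrite col_p // xD.
case: eqP => // _; case: ifP => // /andP[/PJP0].
by rewrite P0E // => /setDP[/setDP[_ /negP]].
Qed.

(** * Satisfied edges of [h] and of [mu] *)

Let sat_PJ_leaf x : x \in L0 -> x \notin K -> p x \in PJ -> sat col x (p x).
Proof.
move=> xL xK pP; rewrite satC.
have e : col (p x) (mu (p x)) = 1.
  by apply/eqP; rewrite col_p_1 // pP eqxx.
apply: (@sat_intro _ _ _ _ (mu (p x))); rewrite ?e //.
- exact/nesym/neq_mu_p.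
- by move=> z' /eqP; rewrite col_p_1 // => /andP[_ /eqP].
by move=> z'; case: (col_30 z' (L0X xL) (L0D xL) xK) => ->.
Qed.

Let sat_K x y : x \in K -> ~~ side y -> (forall z, col y z <> 3) -> sat col x y.
Proof.
move=> xK yY n3; have xX := L0X (KL xK).
have ne : (mu x == p x) = false.
  exact/eqP/nesym/neq_p_mu/KL.
have e : col x (mu x) = 3 by rewrite col_K // ne eqxx.
apply: (@sat_intro _ _ _ _ (mu x)); rewrite ?e //.
  by apply: side_neq; rewrite ?mu_side.
move=> z'; rewrite col_K //; case: ifP => _.
  by case: (kcol12 x) => ->.
by case: eqP.
Qed.

(** The cases are a reserved leaf [y], a non-centre [x], a centre with [y] not its private
    neighbour, and the private edge. Only leaf edges with nothing coloured at either end escape. *)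
Let sat_h x y : side x -> h x y ->
  sat col x y \/ [/\ x \in L0, x \notin K, x \notin J1, y = p x & p x \notin PJ].
Proof.
move=> xX hxy; have yY := hX hxy xX.
case: (boolP (y \in p @: Lf)) => [/imsetP[x' x'L ye]|yp].
  have ex : x = x' by apply: p_leaf => //; rewrite -ye.
  rewrite {}ye -{}ex in hxy x'L yY *.
  case: (boolP (x \in D')) => xD.
    left; have e : col x (q x) = 1 by apply/eqP; rewrite col_D1_1 ?D'D1.
    apply: (@sat_intro _ _ _ _ (q x)); rewrite ?e //.
    - by move=> e'; move: (qY (D'D1 xD)); rewrite e' pY1.
    - by move=> z' /eqP; rewrite col_D1_1 ?D'D1 // => /eqP.
    by move=> z'; apply: col_p_neq1.
  have xL : x \in L0 by apply/setDP.
  case: (boolP (x \in K)) => xK.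
    left; apply: sat_K => // z; rewrite col_p // (negbTE xD) xK.
    case: ifP => _; first by case: (kcol12 x) => ->.
    by case: ifP.
  case: (boolP (p x \in PJ)) => pP; first by left; apply: sat_PJ_leaf.
  by right; split=> //; apply: contra pP => /J1PJ.
left; have yY1 : y \in Y1.
  by rewrite inE yY yp andbT; apply/existsP; exists x.
case: (boolP (x \in D1)) => xD; last first.
  case: (boolP (x \in K)) => xK.
    apply: sat_K => // z; rewrite col_Y1 //; case: ifP => _; first by case: ifP.
    (* A 3 at [y] would make it the private neighbour of a leafless centre, which by [qA] has no
       neighbour in [Lf]. *)
    case: ifP => // /and3P[sA /eqP ye _].
    by move: (qA sA (L0L (KL xK))); rewrite -ye hxy.
  (* The edge from [y] to its centre has colour 1 or 2, while [x] sees at most 3s. *)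
  rewrite satC; apply: (@sat_intro _ _ _ _ (s y)); rewrite ?(col_Y1 (s y) yY1) ?eqxx.
  - by move=> e; move: xD; rewrite -e sD.
  - by case: ifP.
  - by move=> z'; rewrite col_Y1 //; case: (z' =P s y) => // _; do 2!case: ifP => //.
  by move=> z'; case: (col_30 z' xX xD xK) => ->; case: ifP.
case: (y =P q x) => [ye|yn]; last first.
  have e : col x (q x) = 1 by apply/eqP; rewrite col_D1_1.
  apply: (@sat_intro _ _ _ _ (q x)); rewrite ?e //; first exact: nesym.
    by move=> z' /eqP; rewrite col_D1_1 // => /eqP.
  move=> z'; rewrite col_Y1 //; case: ifP => _; last by case: ifP.
  (* If [y] saw a 1, it would be private to [s y], so [x] would be [s y] and [y] would be [q x]. *)
  case: (y =P q (s y)) => // ye.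
  by case: yn; rewrite ye in hxy *; rewrite (q_priv (sD yY1) xD hxy) -ye.
have sy : s y = x by rewrite ye s_q.
(* The private edge is satisfied by colour 3: on the leaf edge of a centre with a leaf, otherwise on
   the extra edge at [q x]. *)
case: (boolP (x \in A)) => xA; last first.
  have xD' : x \in D' by move: xD; rewrite inE (negbTE xA).
  have e : col x (p x) = 3 by apply/eqP; rewrite col_D'_3.
  apply: (@sat_intro _ _ _ _ (p x)); rewrite ?e //.
  - by move=> e'; move: yY1; rewrite -e' pY1 // D'L.
  - by move=> z' /eqP; rewrite col_D'_3 // => /eqP.
  move=> z'; rewrite col_Y1 // sy (negbTE xA); case: ifP => //= _.
  by case: ifP.
have e : col y (r x) = 3.
  rewrite col_Y1 // sy xA -ye !eqxx /=.
  by case: eqP => // /(r_neq xA).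
rewrite satC; apply: (@sat_intro _ _ _ _ (r x)); rewrite ?e //.
- exact: r_neq.
- move=> z'; rewrite col_Y1 // sy; case: ifP => _; first by case: ifP.
  by case: ifP => // /and3P[_ _ /eqP].
by move=> z'; apply: col_A_3.
Qed.

(** The leaf edge at [x] serves: [mu x] either lies in [K] and its leaf edge has the other colour,
    or it sees only 3s. *)
Let sat_mu_K x : x \in K -> sat col x (mu x).
Proof.
move=> xK; have xL := KL xK; have := xK; rewrite inE => /and3P[_ ne mD].
have e : col x (p x) = kcol x by rewrite col_K // eqxx.
apply: (@sat_intro _ _ _ _ (p x)); rewrite ?e //.
- exact: neq_p_mu.
- by case: (kcol12 x) => ->.
- move=> z'; rewrite col_K //; case: eqP => // _.
  by case: ifP => _; case: (kcol12 x) => ->.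
move=> z'; case: (boolP (mu x \in K)) => mK; last first.
  by case: (col_30 z' _ mD mK); rewrite ?mu_side ?L0X // => ->; case: (kcol12 x) => ->.
have K1E w : w \in K -> (w \in K1) = (rk w < rk (mu w)).
  by rewrite [w \in K1]inE => ->.
rewrite col_K // /kcol !K1E // muK; case: ifP => _; last first.
  by do 2!case: ifP => //.
by case: ltngtP => // /val_inj /enum_rank_inj e'; move: ne; rewrite e' eqxx.
Qed.

(** Colour 3 on the leaf edge serves: the partner of [p x] is isolated in [h], or is a leaf of
    larger rank, whose own edge gets no 3. *)
Let sat_mu_J x : x \in J1 -> sat col (p x) (mu (p x)).
Proof.
move=> xJ; have := xJ; rewrite inE => /andP[/setDP[xL0 xK] /andP[ne H]].
have xL := L0L xL0; have xD : (x \in D') = false by case/setDP: xL0 => _ /negbTE.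
have e : col (p x) x = 3 by rewrite col_p // eqxx xD (negbTE xK) xJ.
apply: (@sat_intro _ _ _ _ x); rewrite ?e //; first exact: neq_mu_p.
  by move=> z'; rewrite col_p //; case: eqP => // _; case: ifP.
move=> z'; case/orP: H => [mI|/andP[/imsetP[x']]].
  by rewrite col_iso ?mu_side ?pY //; case: ifP.
case/setDP=> x'L0 x'K me lt; have x'L := L0L x'L0.
have x'D : (x' \in D') = false by case/setDP: x'L0 => _ /negbTE.
rewrite me col_p // x'D (negbTE x'K); case: ifP => _; last by case: ifP.
case: ifP => //; rewrite inE -me muK pNiso //= => /andP[_ /andP[_ /andP[_]]].
by rewrite ltnNge ltnW.
Qed.

Let sat_mu_PJ y : y \in PJ -> sat col y (mu y).
Proof.
move=> yP; have := yP; rewrite inE => /andP[/imsetP[x xLK ye] /andP[ne H]].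
rewrite {y}ye in yP ne H *; case/orP: H => [mI|mP].
  by apply: sat_mu_J; rewrite inE xLK ne mI.
case: (ltngtP (rk (p x)) (rk (mu (p x)))) => [lt|lt|].
- by apply: sat_mu_J; rewrite inE xLK ne mP lt orbT.
- case/imsetP: mP => x' x'LK me.
  rewrite satC -{2}[p x]muK me; apply: sat_mu_J.
  by rewrite inE x'LK -me muK eq_sym ne lt andbT imset_f ?orbT.
by move/val_inj/enum_rank_inj => e; move: ne; rewrite -e eqxx.
Qed.

(** Being outside [K] forces [mu x] to be a centre; its single edge of colour 1 serves, as [x] sees
    no colour. *)
Let sat_mu_idle x : x \in L0 -> x \notin K -> x \notin J1 ->
  mu x <> x -> sat col x (mu x).
Proof.
move=> xL xK xJ /eqP ne.
have mD : mu x \in D1.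
  by apply: contraR xK => mD; rewrite inE xL ne mD.
rewrite satC; have e : col (mu x) (q (mu x)) = 1 by apply/eqP; rewrite col_D1_1.
apply: (@sat_intro _ _ _ _ (q (mu x))); rewrite ?e //.
- by apply: side_neq'; [apply: L0X | apply/Y1Y/qY].
- by move=> z' /eqP; rewrite col_D1_1 // => /eqP.
by move=> z'; rewrite col_idle.
Qed.

(** As [p x] sees no colour, any unique colour at its partner serves. The partner is neither
    isolated in [h] nor in [P0], hence a coloured reserved leaf or a vertex of [Y1]. *)
Let sat_mu_p_idle x : x \in L0 -> x \notin K -> x \notin J1 -> p x \notin PJ ->
  mu (p x) <> p x -> sat col (p x) (mu (p x)).
Proof.
move=> xL0 xK xJ pJ /eqP ne; have xL := L0L xL0.
have c0 z : col (p x) z = 0.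
  rewrite col_p // (negbTE xK) (negbTE xJ) (negbTE pJ) /=.
  by case/setDP: xL0 => _ /negbTE ->; case: ifP.
have pP : p x \in P0 by rewrite P0E //; apply/setDP.
have := pJ; rewrite inE pP ne /= negb_or => /andP[mI mP].
have wY : ~~ side (mu (p x)) by rewrite mu_side pY.
rewrite satC; move: (mu (p x)) mI mP wY => w mI mP wY.
case: (boolP (w \in p @: Lf)) => [/imsetP[x' x'L we]|wp].
  rewrite {w}we in mI mP wY *.
  have nP : (p x' \in PJ) = false by apply: contraNF mP => /PJP0.
  have [c c0' ce] : exists2 c, 0 < c &
      forall z, col (p x') z = if z == x' then c else 0.
    case: (boolP (x' \in D')) => x'D.
      by exists 3 => // z; rewrite col_p // x'D nP.
    have x'K : x' \in K.
      apply: contraR mP => x'K; rewrite P0E //.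
      by apply/setDP; split=> //; apply/setDP.
    exists (kcol x'); first by case: (kcol12 x') => ->.
    by move=> z; rewrite col_p // (negbTE x'D) x'K nP.
  apply: (@sat_intro _ _ _ _ x'); rewrite ?ce ?eqxx //.
  - by apply: side_neq; [apply: LfX | apply: pY].
  - by move=> z'; rewrite ce; case: eqP => // _ e; move: c0'; rewrite -e.
  by move=> z'; rewrite c0 => e; move: c0'; rewrite -e.
have wY1 : w \in Y1 by rewrite inE wY wp andbT; apply: negbNE.
apply: (@sat_intro _ _ _ _ (s w)); rewrite ?(col_Y1 (s w) wY1) ?eqxx.
- by apply: side_neq; [apply: sX | apply: pY].
- by case: ifP.
- by move=> z'; rewrite col_Y1 //; case: (z' =P s w) => // _; do 2!case: ifP => //.
by move=> z'; rewrite c0; case: ifP.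
Qed.

(** * Unsatisfied edges form an uncoloured matching *)

(** Escaping edges of [h] are disjoint since [p] is injective and leaves have one neighbour; an edge
    of [mu] meeting one is satisfied by the idle cases. *)
Lemma bipartite_colouring_of_domination :
  let e u v := h u v || (v == mu u) && (v != u) in
  exists c : T -> T -> nat,
    [/\ forall u v, c u v = c v u,
        forall u v, c u v <= 3,
        forall u v, 0 < c u v -> e u v,
        forall u v, 0 < c u v -> sat c u v &
        forall u v w, e u v -> e u w -> v <> w -> sat c u v || sat c u w].
Proof.
move=> e.
have kcol3 x : kcol x <= 3 by case: (kcol12 x) => ->.
have colh_h x y : 0 < colh x y -> h x y.
  rewrite /colh; case: ifP => [/andP[xL /eqP ->] _|_]; first exact: ph.
  case: ifP => // yY; case: eqP => [-> _|_]; first exact: sh.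
  by case: ifP => // /and3P[sA /eqP ye /eqP ->] _; rewrite {2}ye; apply: rh.
have mu_sat u v : v = mu u -> v <> u -> 0 < col u v -> sat col u v.
  move=> ve ne; rewrite /col ve mu_side eqxx /colm eqxx /=; case: ifP => // _.
  case: ifP => uX; case: ifP => // /orP[H|H] _; try exact: sat_mu_K; try exact: sat_mu_PJ.
    by rewrite satC -{2}[u]muK; apply: sat_mu_K.
  by rewrite satC -{2}[u]muK; apply: sat_mu_PJ.
have e_col u v : 0 < col u v -> e u v.
  rewrite /e /col; case: eqP => _.
    by rewrite /colm; case: ifP; rewrite ?orbT.
  by case: ifP => _ /colh_h; rewrite // hC => ->.
have h_m u v w : h u v -> w = mu u -> w <> u -> sat col u v || sat col u w.
  move=> huv -> /eqP ne; apply/orP; case: (boolP (side u)) => uX.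
    case: (sat_h uX huv) => [|[uL uK uJ _ _]]; first by left.
    by right; apply: sat_mu_idle => //; apply/eqP.
  rewrite hC in huv; have vX := hY huv uX.
  rewrite satC; case: (sat_h vX huv) => [|[vL vK vJ ue pJ]]; first by left.
  by right; rewrite ue in ne *; apply: sat_mu_p_idle => //; apply/eqP.
exists col; split=> //.
- move=> u v; rewrite /col /colh /colm.
  by do ![case: ifP => // _ | exact: kcol3].
- move=> u v c0; have /orP[huv|/andP[/eqP ve /eqP ne]] := e_col _ _ c0; last exact: mu_sat.
  wlog uX : u v c0 huv / side u.
    move=> H; case: (boolP (side u)) => uX; first exact: H.
    rewrite satC; rewrite colC in c0; rewrite hC in huv.
    by apply: H => //; apply: hY huv uX.
  case: (sat_h uX huv) => // -[uL uK uJ _ _].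
  by move: c0; rewrite col_idle.
move=> u v w /orP[huv|/andP[/eqP ve /eqP vn]] /orP[huw|/andP[/eqP we /eqP wn]] vw.
- apply/orP; case: (boolP (side u)) => uX.
    case: (sat_h uX huv) => [|[_ _ _ ve _]]; first by left.
    case: (sat_h uX huw) => [|[_ _ _ we _]]; first by right.
    by case: vw; rewrite ve we.
  rewrite hC in huv; rewrite hC in huw; rewrite ![sat col u _]satC.
  case: (sat_h (hY huv uX) huv) => [|[/L0L vL _ _ ve _]]; first by left.
  case: (sat_h (hY huw uX) huw) => [|[/L0L wL _ _ we _]]; first by right.
  by case: vw; apply: p_inj => //; rewrite -ve -we.
- exact: h_m.
- by rewrite orbC; apply: h_m.
by case: vw; rewrite ve we.
Qed.

End BipartiteStep.

(** * Choice of leaves, centres and private neighbours *)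

Lemma bipartite_colouring (T : finType) (side : pred T) (h : rel T) (mu : T -> T) :
  symmetric h -> (forall x y, h x y -> side x != side y) ->
  involutive mu -> (forall x, side (mu x) = side x) ->
  let e u v := h u v || (v == mu u) && (v != u) in
  exists c : T -> T -> nat,
    [/\ forall u v, c u v = c v u,
        forall u v, c u v <= 3,
        forall u v, 0 < c u v -> e u v,
        forall u v, 0 < c u v -> sat c u v &
        forall u v w, e u v -> e u w -> v <> w -> sat c u v || sat c u w].
Proof.
move=> hC h_side muK mu_side.
pose leaf x y := h x y && [forall z, h z y ==> (z == x)].
pose Lf := [set x | side x & [exists y, leaf x y]].
have [p pP] : exists p : T -> T, forall x, x \in Lf -> leaf x (p x).
  apply: (@fin_all_exists _ _ (fun x y => x \in Lf -> leaf x y)) => x.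
  case: (boolP (x \in Lf)) => [|_]; last by exists x.
  by rewrite inE => /andP[_ /existsP[y]]; exists y.
pose Y1 := [set y | [&& ~~ side y, [exists x, h x y] & y \notin p @: Lf]].
pose Ya := [set y in Y1 | [forall x in Lf, ~~ h x y]].
(* First round: vertices of [Y1] with no neighbour in [Lf] are dominated from outside [Lf]. *)
have [A [/subsetP sA domA privA]] :
  exists A : {set T}, [/\ A \subset [set x | side x & x \notin Lf],
    forall y, y \in Ya -> exists2 x, x \in A & h x y &
    forall d, d \in A -> exists q, [/\ q \in Ya, h d q &
      forall d', d' \in A -> h d' q -> d' = d]].
  apply: minimal_domination => y.
  rewrite !inE => /andP[/and3P[yY /existsP[x hxy] _] /forall_inP nL].
  exists x => //; rewrite inE; apply/andP; split; last first.
    by apply/negP=> /nL; rewrite hxy.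
  by have := h_side _ _ hxy; rewrite (negbTE yY); case: (side x).
pose Y' := [set y in Y1 | [forall x in A, ~~ h x y]].
(* Second round: whatever [A] misses is not in [Ya], hence has a neighbour in [Lf]. *)
have [D [/subsetP sD domD privD]] :
  exists D : {set T}, [/\ D \subset Lf,
    forall y, y \in Y' -> exists2 x, x \in D & h x y &
    forall d, d \in D -> exists q, [/\ q \in Y', h d q &
      forall d', d' \in D -> h d' q -> d' = d]].
  apply: minimal_domination => y /setIdP[yY /forall_inP nA].
  have : y \notin Ya by apply/negP=> /domA[x /nA /negP].
  rewrite inE yY /= negb_forall_in => /exists_inP[x xL].
  by rewrite negbK; exists x.
have [s sP] : exists s : T -> T, forall y, y \in Y1 -> s y \in A :|: D /\ h (s y) y.
  apply: (@fin_all_exists _ _ (fun y d => y \in Y1 -> d \in A :|: D /\ h d y)) => y.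
  case: (boolP (y \in Y1)) => [yY|_]; last by exists y.
  case: (boolP (y \in Y')) => [/domD[d dD hdy]|].
    by exists d; rewrite inE dD orbT.
  rewrite inE yY /= negb_forall_in => /exists_inP[d dA]; rewrite negbK => hdy.
  by exists d; rewrite inE dA.
have AL x : x \in A -> x \notin Lf by move/sA; rewrite inE => /andP[].
have AX x : x \in A -> side x by move/sA; rewrite inE => /andP[].
pose qspec d y := [/\ y \in Y1, h d y,
  forall d', d' \in A :|: D -> h d' y -> d' = d &
  d \in A -> forall x, x \in Lf -> ~~ h x y].
(* Privacy survives the union: private neighbours from the first round have no neighbour in [Lf],
   those from the second none in [A]. *)
have [q qP] : exists q : T -> T, forall d, d \in A :|: D -> qspec d (q d).
  apply: (@fin_all_exists _ _ (fun d y => d \in A :|: D -> qspec d y)) => d.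
  case: (boolP (d \in A :|: D)) => [|_]; last by exists d.
  case/setUP=> [/privA|dD].
    case=> y [/setIdP[yY /forall_inP nL] hdy uq]; exists y; split=> //.
    by move=> d' /setUP[/uq //|/sD /nL /negP].
  have [y [/setIdP[yY /forall_inP nA] hdy uq]] := privD _ dD.
  exists y; split=> //; first by move=> d' /setUP[/nA /negP|/uq].
  by move/AL; rewrite sD.
have AD d : d \in A -> d \in A :|: D by rewrite inE => ->.
have [r rP] : exists r : T -> T, forall d, d \in A -> h (r d) (q d) /\ r d <> d.
  apply: (@fin_all_exists _ _ (fun d x => d \in A -> h x (q d) /\ x <> d)) => d.
  case: (boolP (d \in A)) => [dA|_]; last by exists d.
  have [_ hdq _ _] := qP _ (AD _ dA).
  (* A centre outside [Lf] has no leaf, so [q d] has a second neighbour, to be used as [r d]. *)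
  have : ~~ leaf d (q d).
    apply: contra (AL _ dA) => lf; rewrite inE AX //.
    by apply/existsP; exists (q d).
  rewrite negb_and hdq /= negb_forall => /existsP[x]; rewrite negb_imply.
  by case/andP=> hx /eqP; exists x.
apply: (@bipartite_colouring_of_domination T side h mu hC h_side muK mu_side
          Lf A D p q s r) => //.
- by move=> x; rewrite inE => /andP[].
- by move=> x /pP /andP[].
- by move=> x z /pP /andP[_ /forallP /(_ z) /implyP H] /H /eqP.
- by move=> y /sP[].
- by move=> y /sP[].
- by move=> d dD; have [] := qP _ dD.
- by move=> d d' dD; have [_ _ H _] := qP _ dD; apply: H.
- by move=> d x dA; have [_ _ _] := qP _ (AD _ dA); apply.
- by move=> d dA; have [] := rP _ dA.
by move=> d dA; have [] := rP _ dA.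
Qed.

(** * Induction on the number of bits *)

(** Satisfaction of all coloured edges is part of the induction: unsatisfied edges are then
    uncoloured, and the next three colours may be put on them. *)
Lemma log_colouring (T : finType) (k : nat) (g : rel T) (f : T -> nat) :
  symmetric g -> (forall x, f x < 2 ^ k) -> (forall x y, g x y -> f x <> f y) ->
  exists c : T -> T -> nat,
    [/\ forall u v, c u v = c v u,
        forall u v, c u v <= 3 * k,
        forall u v, 0 < c u v -> g u v,
        forall u v, 0 < c u v -> sat c u v &
        forall u v w, g u v -> g u w -> v <> w -> sat c u v || sat c u w].
Proof.
elim: k g f => [|k IHk] g f gC f_lt f_proper.
  have ng u v : g u v = false.
    apply/negP=> /f_proper; have := f_lt u; have := f_lt v.
    by rewrite expn0 !ltnS !leqn0 => /eqP -> /eqP ->.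
  by exists (fun _ _ => 0); split=> // u v w; rewrite ng.
(* The lowest bit gives the sides; halving gives labels for the inner graph. *)
pose side x := odd (f x).
pose g' u v := g u v && (side u == side v).
have g'C : symmetric g' by move=> u v; rewrite /g' gC eq_sym.
have [x|x y|a [aC a_le a_g a_sat a_match]] := IHk g' (fun x => (f x)./2) g'C.
- by rewrite ltn_half_double -mul2n -expnS.
- move=> /andP[gxy /eqP sxy] e; apply: (f_proper _ _ gxy).
  by rewrite -[f x]odd_double_half -[f y]odd_double_half e -/(side x) sxy.
pose m u v := g' u v && ~~ sat a u v.
have mC u v : m u v = m v u by rewrite /m g'C satC.
have m_fun u v w : m u v -> m u w -> v = w.
  case/andP=> uv /negbTE nv /andP[uw /negbTE nw]; apply/eqP.
  by case: eqVneq => // /eqP /(a_match _ _ _ uv uw); rewrite nv nw.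
have m_irr u : m u u = false.
  by apply/negP=> /andP[/andP[guu _] _]; apply: (f_proper _ _ guu).
(* [mu] swaps the ends of each unsatisfied inner edge and fixes all other vertices. *)
pose mu u := odflt u [pick v | m u v].
have muP u v : m u v = (v == mu u) && (v != u).
  rewrite /mu; case: pickP => [w muw|nm] /=; last by rewrite nm andbN.
  apply/idP/andP=> [muv|[/eqP -> _]] //.
  rewrite (m_fun _ _ _ muv muw) eqxx; split=> //.
  by apply/eqP=> e; move: muw; rewrite e m_irr.
have mu_m u : mu u != u -> m u (mu u) by rewrite muP eqxx.
have muK : involutive mu.
  move=> u; case: (eqVneq (mu u) u) => [e|/mu_m]; first by rewrite !e.
  by rewrite mC muP => /andP[/eqP <-].
have mu_side u : side (mu u) = side u.
  case: (eqVneq (mu u) u) => [-> //|/mu_m /andP[/andP[_ /eqP ->] _]] //.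
pose h u v := g u v && (side u != side v).
have hC : symmetric h by move=> u v; rewrite /h gC eq_sym.
have hS u v : h u v -> side u != side v by case/andP.
have [b [bC b_le b_e b_sat b_match]] := bipartite_colouring hC hS muK mu_side.
pose c u v := if 0 < b u v then 3 * k + b u v else a u v.
(* No edge is coloured twice: [b] colours only crossing edges and inner edges that [a] leaves
   unsatisfied, hence uncoloured. *)
have a0 u v : 0 < a u v -> b u v = 0.
  move=> a0; apply/eqP; rewrite -leqn0 leqNgt; apply/negP=> /b_e.
  rewrite -muP => /orP[/hS|/andP[_]]; last by rewrite a_sat.
  by have /andP[_ ->] := a_g _ _ a0.
have cE_a u v u' v' : 0 < a u v -> (c u' v' == c u v) = (a u' v' == a u v).
  move=> av; rewrite /c (a0 _ _ av) /=; case: ifP => // b0.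
  have -> : a u' v' = 0.
    by apply/eqP; rewrite -leqn0 leqNgt; apply/negP=> /a0 e; rewrite e in b0.
  have lt : a u v < 3 * k + b u' v' by rewrite (leq_ltn_trans (a_le u v)) // -ltn_subLR // subnn.
  by rewrite gtn_eqF // ltn_eqF.
have cE_b u v u' v' : 0 < b u v -> (c u' v' == c u v) = (b u' v' == b u v).
  move=> bv; rewrite /c bv; case: ifP => [_|/negbT]; first by rewrite eqn_add2l.
  rewrite -eqn0Ngt => /eqP ->; rewrite ltn_eqF; first by rewrite ltn_eqF.
  by rewrite (leq_ltn_trans (a_le _ _)) // -ltn_subLR // subnn.
(* The shift by [3 * k] separates the palettes, so a unique colour of [a] or of [b] stays unique in
   [c]. *)
have sat_at_c (d : T -> T -> nat) u v :
    (forall u v u' v', 0 < d u v -> (c u' v' == c u v) = (d u' v' == d u v)) ->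
    (forall u v, 0 < d u v -> 0 < c u v) -> sat_at d u v -> sat_at c u v.
  move=> dE d0 /sat_atP[z [zv dz uq nv]]; apply/sat_atP; exists z; split=> //.
  - exact: d0.
  - by move=> z' /eqP; rewrite dE // => /eqP; apply: uq.
  by move=> z' /eqP; rewrite dE // => /eqP; apply: nv.
have sat_c_a u v : sat a u v -> sat c u v.
  have c0 x y : 0 < a x y -> 0 < c x y by move=> ax; rewrite /c a0.
  by case/orP=> /(sat_at_c _ _ _ cE_a c0) H; rewrite /sat H ?orbT.
have sat_c_b u v : sat b u v -> sat c u v.
  have c0 x y : 0 < b x y -> 0 < c x y by move=> bx; rewrite /c bx addn_gt0 bx orbT.
  by case/orP=> /(sat_at_c _ _ _ cE_b c0) H; rewrite /sat H ?orbT.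
have g_sat u v : g u v -> sat c u v \/ h u v || (v == mu u) && (v != u).
  move=> guv; rewrite /h guv -muP /m /g' guv /=.
  by case: eqP => //= _; [case: (boolP (sat a u v)) => [/sat_c_a|]|]; auto.
exists c; split.
- by move=> u v; rewrite /c bC aC.
- move=> u v; rewrite /c mulnS; case: ifP => _; first by rewrite addnC leq_add2r.
  by apply: leq_trans (a_le u v) _; apply: leq_addl.
- move=> u v; rewrite /c; case: ifP => [b0 _|_ /a_g /andP[]//].
  by have := b_e _ _ b0; rewrite -muP => /orP[/andP[]|/andP[/andP[]]].
- move=> u v; rewrite /c; case: ifP => [b0 _|_ ax]; first exact/sat_c_b/b_sat.
  exact/sat_c_a/a_sat.
move=> u v w guv guw vw.
case: (g_sat _ _ guv) => [->//|euv].
case: (g_sat _ _ guw) => [->|euw]; first by rewrite orbT.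
by case/orP: (b_match _ _ _ euv euw vw) => /sat_c_b ->; rewrite ?orbT.
Qed.

(** * Passage from pairs of vertices to edges as sets *)

Lemma set2_inj (T : finType) (u v a b : T) :
  u != v -> [set u; v] = [set a; b] -> u = a /\ v = b \/ u = b /\ v = a.
Proof.
move=> uv e.
have /set2P[ua|ub] : u \in [set a; b] by rewrite -e set21.
  have /set2P[va|vb] : v \in [set a; b] by rewrite -e set22.
    by move: uv; rewrite ua va eqxx.
  by left.
have /set2P[va|vb] : v \in [set a; b] by rewrite -e set22.
  by right.
by move: uv; rewrite ub vb eqxx.
Qed.

Theorem mainTheorem9 (T : finType) (g : rel T) (alpha : nat) :
  symmetric g -> irreflexive g -> 1 <= alpha -> colourable g alpha ->
  exists (c : {set T} -> option 'I_(3 * up_log 2 alpha)) (M : {set {set T}}),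
    [/\ matching g M,
        (forall A, A \in M -> c A = None) &
        (forall A, is_edge g A -> A \notin M -> satisfied g c A)].
Proof.
move=> gC gI _ [f f_proper].
set k := up_log 2 alpha.
have [x|x y gxy|c [cC c_le c_g c_sat c_match]] :=
  @log_colouring T k g (fun x => f x : nat) gC.
- exact: leq_trans (ltn_ord _) (up_logP _ _).
- by move/val_inj/eqP; apply/negP/f_proper.
have g_neq u v : g u v -> u != v.
  by apply: contraTneq => ->; rewrite gI.
(* An orientation of the edge is picked, harmless as [c] is symmetric. Colours 1 to [3 * k] move
   down by one to fit the ordinal type. *)
pose cs (A : {set T}) : option 'I_(3 * k) :=
  if [pick uv : T * T | g uv.1 uv.2 && (A == [set uv.1; uv.2])] is Some uv
  then if 0 < c uv.1 uv.2 then insub (c uv.1 uv.2).-1 else None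
  else None.
have csE u v : g u v ->
    cs [set u; v] = if 0 < c u v then insub (c u v).-1 else None.
  move=> guv; rewrite /cs; case: pickP => [[a b] /= /andP[gab /eqP e]|].
    by case: (set2_inj (g_neq _ _ guv) e) => -[-> ->] //; rewrite cC.
  by move/(_ (u, v)); rewrite /= guv eqxx.
pose M := [set A | [exists u, exists v,
  [&& g u v, ~~ sat c u v & A == [set u; v]]]].
have MP A : reflect (exists u v, [/\ g u v, ~~ sat c u v & A = [set u; v]]) (A \in M).
  rewrite inE; apply: (iffP existsP) => -[u].
    by case/existsP=> v /and3P[? ? /eqP ?]; exists u, v.
  by case=> v [guv ns ->]; exists u; apply/existsP; exists v; rewrite guv ns eqxx.
have edgeP A : reflect (exists u v, g u v /\ A = [set u; v]) (is_edge g A).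
  apply: (iffP existsP) => -[u].
    by case/existsP=> v /andP[? /eqP ?]; exists u, v.
  by case=> v [guv ->]; exists u; apply/existsP; exists v; rewrite guv eqxx.
exists cs, M; split.
- split=> [A /MP[u [v [guv _ ->]]]|]; first by apply/edgeP; exists u, v.
  have M2 A x : A \in M -> x \in A -> exists y, [/\ g x y, ~~ sat c x y & A = [set x; y]].
    case/MP=> u [v [guv ns ->]] /set2P[] ->; first by exists v.
    by exists u; rewrite gC satC setUC.
  move=> A B AM BM; apply: contraNT => /pred0Pn[x /= /andP[xA xB]].
  have [y [gxy /negbTE ny ->]] := M2 _ _ AM xA.
  have [z [gxz /negbTE nz ->]] := M2 _ _ BM xB.
  apply/eqP; congr [set x; _]; apply/eqP; case: eqVneq => // /eqP yz.
  by have := c_match _ _ _ gxy gxz yz; rewrite ny nz.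
- move=> A /MP[u [v [guv ns ->]]]; rewrite csE //.
  by case: ifP => // /c_sat; rewrite (negbTE ns).
move=> A /edgeP[u [v [guv ->]]] AM.
have : sat c u v by apply: contraR AM => ns; apply/MP; exists u, v.
wlog st : u v guv {AM} / sat_at c u v.
  move=> H /orP[] st; first by apply: H => //; rewrite /sat st.
  by rewrite setUC; apply: H => //; rewrite 1?gC // /sat st.
move=> _; case/sat_atP: st => z [zv cz uq nv].
have guz := c_g _ _ cz.
have lt : (c u z).-1 < 3 * k by rewrite prednK.
exists (Ordinal lt), [set u; z]; split.
- apply/andP; split; first by apply/edgeP; exists u, z.
  by apply/set0Pn; exists u; rewrite !inE eqxx.
- apply/eqP=> e; have : z \in [set u; v] by rewrite -e !inE eqxx orbT.
  by rewrite !inE => /orP[/eqP zu|/eqP //]; move: guz; rewrite zu gI.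
- by rewrite csE // cz insubT.
move=> f' /andP[/edgeP[a0 [b0 [g0 e0]]] /set0Pn[x /setIP[xf xA]]] ne.
have [b [gxb {a0 b0 g0 e0} fe]] : exists b, g x b /\ f' = [set x; b].
  move: xf; rewrite e0 => /set2P[] ->; first by exists b0.
  by exists a0; rewrite gC setUC.
rewrite fe csE //; case: ifP => // cx.
(* Both colours are positive, so equality after the shift gives equality before it. *)
rewrite insubT ?prednK // => lt' [] /(congr1 succn); rewrite !prednK // => {lt'}e.
case/set2P: xA => xe; rewrite {x}xe in fe e gxb xf cx.
  by move: ne; rewrite fe (uq _ e) eqxx.
exact: nv e.
Qed.
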